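(* Let $\mathbf{B}^2=\{(x,y)\in\mathbb{R}^2:x^2+y^2\leqslant1\}$ and $\mathbf{T}^2=\{(x,y)\in\mathbb{R}^2:x,y\geqslant0,\ x+y\leqslant1\}$. Let $W^{\mathbf{B}}(x,y)=W(x^2,y^2)$ be a weight function on $\mathbf{B}^2$, and let $\{\mathbb{S}_n\}_{n\geqslant0}$, $\mathbb{S}_n=[S_{n,0},\dots,S_{n,n}]^\top$, be the monic orthogonal polynomial system associated with $W^{\mathbf{B}}$. Let the big vector polynomials $\mathbb{P}_n^{(i,j)}$, $i,j\in\{0,1\}$, be determined by $$\mathbb{S}_{2n}(x,y)=\mathbb{P}_n^{(0,0)}(x^2,y^2)+x\,y\,\mathbb{P}_{n-1}^{(1,1)}(x^2,y^2),\qquad \mathbb{S}_{2n+1}(x,y)=x\,\mathbb{P}_n^{(1,0)}(x^2,y^2)+y\,\mathbb{P}_n^{(0,1)}(x^2,y^2),$$ and let $\widehat{\mathbb{P}}_n^{(i,j)}=\mathrm{J}_n^{(i,j)}\,\mathbb{P}_n^{(i,j)}$. Then, on $\mathbf{T}^2$: (i) $\{\widehat{\mathbb{P}}_n^{(0,0)}\}_{n\geqslant0}$ is the monic orthogonal polynomial system associated with $W^{(0,0)}(x,y)=\dfrac{1}{\sqrt{xy}}\,W^{\mathbf{B}}(\sqrt{x},\sqrt{y})$; (ii) for $k=1,2$ (with $x_1=x$, $x_2=y$), $\{\widehat{\mathbb{P}}_n^{(2-k,k-1)}\}_{n\geqslant0}$ is the monic orthogonal polynomial system associated with $W^{(2-k,k-1)}(x,y)=x_k\,W^{(0,0)}(x,y)$;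 (iii) $\{\widehat{\mathbb{P}}_n^{(1,1)}\}_{n\geqslant0}$ is the monic orthogonal polynomial system associated with $W^{(1,1)}(x,y)=x\,y\,W^{(0,0)}(x,y)$.
   Context: Weight function on $\Omega\subset\mathbb{R}^2$: a nonnegative function $W$ on $\Omega$ with positive integral and all moments $\int_\Omega x^hy^kW\,dx\,dy$ finite (defined up to null sets). Polynomial systems: a sequence $\{\mathbb{P}_n\}_{n\geqslant0}$ of column vectors $\mathbb{P}_n=[P_{n,0},\dots,P_{n,n}]^\top$ of real bivariate polynomials, where the $n+1$ entries of $\mathbb{P}_n$ have total degree exactly $n$ and $\{P_{n,m}\}$ is a basis of the space of bivariate polynomials. It is monic if $P_{n,j}(x,y)=x^{n-j}y^j+(\text{polynomial of total degree}\leqslant n-1)$. The monic orthogonal polynomial system associated with $W$ on $\Omega$ is the unique monic system with $\int_\Omega \mathbb{P}_n\mathbb{P}_m^\top W\,dx\,dy=0$ for $n\ne m$ and equal to a symmetric positive-definite matrix for $n=m$. Big vector polynomials: since $W^{\mathbf{B}}$ is even in $x$ and in $y$, each $S_{n,k}$ contains only powers of $x$ of the parity of $n-k$ and only powers of $y$ of the parity of $k$. In the displayed decomposition, indexing entries from $0$: $\mathbb{P}_n^{(0,0)}(x^2,y^2)$ (size $2n+1$) has entries $S_{2n,k}$ for $k$ even and $0$ for $k$ odd; $xy\,\mathbb{P}_{n-1}^{(1,1)}(x^2,y^2)$ (size $2n+1$) has entries $S_{2n,k}$ for $k$ odd and $0$ for $k$ even; $x\,\mathbb{P}_n^{(1,0)}(x^2,y^2)$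 (size $2n+2$) has entries $S_{2n+1,k}$ for $k$ even and $0$ for $k$ odd; $y\,\mathbb{P}_n^{(0,1)}(x^2,y^2)$ (size $2n+2$) has entries $S_{2n+1,k}$ for $k$ odd and $0$ for $k$ even. $\mathbb{P}_{-1}^{(1,1)}=0$. $\mathrm{J}_n^{(i,j)}$, $i,j\in\{0,1\}$, is the $(n+1)\times(2n+1+i+j)$ matrix whose entry (rows and columns indexed from $0$) in position $(h,2h+j)$ is $1$ for $0\leqslant h\leqslant n$, all other entries being $0$. *)

(* Defs.v *)
From HB Require Import structures.
From mathcomp Require Import all_boot all_order all_algebra.
From mathcomp Require mpoly.
(* The notations of mpoly are incompatible with those of mathcomp-analysis. *)
Import -(notations) mpoly.
From mathcomp Require Import all_classical all_reals all_analysis.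

Set Implicit Arguments.
Unset Strict Implicit.
Unset Printing Implicit Defensive.

Import Order.TTheory GRing.Theory Num.Theory.
Import numFieldNormedType.Exports.

Local Open Scope classical_set_scope.
Local Open Scope ring_scope.

Notation bpoly R := (mpoly 2 R).
Notation bpX R := (@mpolyX 2 R (@mnm1 2 ord0)).
Notation bpY R := (@mpolyX 2 R (@mnm1 2 ord_max)).

Definition bpeval (R : realType) (p : bpoly R) (z : R * R) : R :=
  meval (tnth [tuple z.1; z.2]) p.

(* p(x, y) |-> p(x^2, y^2) *)
Definition bpsq (R : realType) (p : bpoly R) : bpoly R :=
  comp_mpoly [tuple bpX R ^+ 2; bpY R ^+ 2] p.

Definition leb2 (R : realType) :
    {measure set (measurableTypeR R * measurableTypeR R)%type -> \bar R} :=
  (@lebesgue_measure R \x @lebesgue_measure R)%E.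

(* Weights are only defined up to null sets, whence the nonnegativity almost
   everywhere. Measurability of W on Omega is the case h = k = 0 of
   [weight_moments]. *)
Record is_weight (R : realType) (Omega : set (R * R)) (W : R * R -> R) : Prop :=
  IsWeight {
    weight_ge0 : {ae leb2 R, forall z, Omega z -> 0 <= W z};
    weight_gt0 : 0 < \int[leb2 R]_(z in Omega) W z;
    weight_moments : forall h k : nat,
      (leb2 R).-integrable Omega (fun z => (z.1 ^+ h * z.2 ^+ k * W z)%:E) }.

(* [P n j 0] is the entry P_{n,j} of the column vector P_n. *)
Definition polyvecs (R : realType) := forall n : nat, 'cV[bpoly R]_n.+1.

Definition lincomb (R : realType) (P : polyvecs R) (N : nat)
    (c : nat -> nat -> R) : bpoly R :=
  \sum_(n < N) \sum_(j < n.+1) c n j *: P n j 0.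

(* msize is the total degree plus one. *)
Record is_polysystem (R : realType) (P : polyvecs R) : Prop := IsPolysystem {
  polysystem_deg : forall (n : nat) (j : 'I_n.+1), msize (P n j 0) = n.+1;
  polysystem_free : forall (N : nat) (c : nat -> nat -> R),
    lincomb P N c = 0 -> forall n j : nat, (j <= n < N)%N -> c n j = 0;
  polysystem_span : forall q : bpoly R,
    exists (N : nat) (c : nat -> nat -> R), q = lincomb P N c }.

Definition is_monic (R : realType) (P : polyvecs R) : Prop :=
  forall (n : nat) (j : 'I_n.+1),
    (msize (P n j 0 - bpX R ^+ (n - j) * bpY R ^+ j)%R <= n)%N.

(* The matrix of the integrals over Omega of the entries of P_n P_m^T W. *)
Definition gram (R : realType) (Omega : set (R * R)) (W : R * R -> R)
    (P : polyvecs R) (n m : nat) : 'M[R]_(n.+1, m.+1) :=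
  \matrix_(i, j)
    \int[leb2 R]_(z in Omega) (bpeval ((P n *m (P m)^T) i j) z * W z).

Definition sym_posdef (R : realType) (n : nat) (A : 'M[R]_n) : Prop :=
  A^T = A /\ forall v : 'cV[R]_n, v != 0 -> 0 < (v^T *m A *m v) 0 0.

Record monic_OPS (R : realType) (Omega : set (R * R)) (W : R * R -> R)
    (P : polyvecs R) : Prop := MonicOPS {
  OPS_weight : is_weight Omega W;
  OPS_polysystem : is_polysystem P;
  OPS_monic : is_monic P;
  OPS_orthogonal : forall n m : nat, n != m -> gram Omega W P n m = 0;
  OPS_posdef : forall n : nat, sym_posdef (gram Omega W P n n) }.

Definition disk (R : realType) : set (R * R) :=
  [set z | z.1 ^+ 2 + z.2 ^+ 2 <= 1].

Definition triangle (R : realType) : set (R * R) :=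
  [set z | [/\ 0 <= z.1, 0 <= z.2 & z.1 + z.2 <= 1]].

Definition diskW (R : realType) (W : R * R -> R) (z : R * R) : R :=
  W (z.1 ^+ 2, z.2 ^+ 2).

(* On the axes, a null set, the inverse takes the conventional value 0. *)
Definition weight00 (R : realType) (WB : R * R -> R) (z : R * R) : R :=
  (Num.sqrt (z.1 * z.2))^-1 * WB (Num.sqrt z.1, Num.sqrt z.2).

(* A family P_n^{(i,j)} of big vectors, of size 2n + 1 + i + j; the summands
   are ordered so that the size computes for concrete i and j. *)
Definition bigvecs (R : realType) (i j : nat) :=
  forall n : nat, 'cV[bpoly R]_(i + j + n.*2.+1).

Definition Jmx (R : realType) (i j n : nat) :
    'M[bpoly R]_(n.+1, i + j + n.*2.+1) :=
  \matrix_(h, l) (l == h.*2 + j :> nat)%N%:R.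

(* Main.v *)
(** The substitution (x, y) = (s^2, t^2) carries the measure
    (x y)^(-1/2) dx dy on the triangle to ds dt on the disk, the Jacobian 4 s t
    being absorbed by the weight and by the four quadrants.  Hence the Gram
    matrices of the big vectors, once rid of their zero entries, are principal
    submatrices of the Gram matrices of [S].  That the odd or even entries are
    indeed zero is the parity of [S n k] in x: both [S n k] and its image under
    x |-> -x are orthogonal to all polynomials of degree less than n, and up to
    sign they have the same leading monomial, so they agree up to sign. *)

Require Import Defs.
From HB Require Import structures.
From mathcomp Require Import all_boot all_order all_algebra.
From mathcomp Require mpoly.
Import -(notations) mpoly.
From mathcomp Require Import all_classical all_reals all_analysis.
From mathcomp Require Import measurable_realfun.
From mathcomp Require Import ring lra zify.

Set Implicit Arguments.
Unset Strict Implicit.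
Unset Printing Implicit Defensive.

Import Order.TTheory GRing.Theory Num.Theory.
Import numFieldNormedType.Exports.

Local Open Scope classical_set_scope.
Local Open Scope ring_scope.

(** * Quadratic substitution in the Lebesgue integral *)

(** A weight need not be continuous, so the substitution has to hold for every Borel integrand. It
    is therefore proved as an equality of two measures, tested on half-open intervals only, and then
    read as an equality of integrals. It is first stated for nonnegative functions with values in
    the extended reals, where neither the unbounded inverse root nor Tonelli's theorem asks for
    integrability; signs come back through positive and negative parts. After that, every integral
    of a polynomial against one of the four weights is a value of a single linear functional on
    polynomials, the moment functional of the disk, and what remains is a comparison of coefficients
    and of matrices. *)

Section density.
Local Open Scope ereal_scope.
Context d (T : measurableType d) (R : realType).
Variables (mu : {measure set T -> \bar R}) (f : T -> R).
Hypotheses (mf : measurable_fun setT f) (f0 : forall x, (0 <= f x)%R).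

(** The two proofs are arguments so that the term itself determines the measure structure registered
    on it below. *)
Definition density of measurable_fun setT f & (forall x, (0 <= f x)%R) :=
  fun A => \int[mu]_(x in A) (f x)%:E.

Let density0 : density mf f0 set0 = 0.
Proof. exact: integral_set0. Qed.

Let density_ge0 A : 0 <= density mf f0 A.
Proof. by apply: integral_ge0 => x _; rewrite lee_fin. Qed.

Let density_sigma_additive : semi_sigma_additive (density mf f0).
Proof.
move=> /= F mF tF mUF; rewrite /density; apply: cvg_toP.
  apply: ereal_nondecreasing_is_cvgn => m n mn.
  apply: lee_sum_nneg_natr => // k _ _; apply: integral_ge0 => /= x _.
  by rewrite lee_fin.
rewrite ge0_integral_bigcup//=.
  exact/measurable_funTS/measurable_EFinP.
by move=> x _; rewrite lee_fin.
Qed.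

HB.instance Definition _ := isMeasure.Build _ _ _
  (density mf f0) density0 density_ge0 density_sigma_additive.

Import HBNNSimple.

(** True for indicators by definition, for simple functions by linearity, and for [h] by monotone
    convergence on both sides. *)
Lemma ge0_integral_density (h : T -> \bar R) :
  measurable_fun setT h -> (forall x, 0 <= h x) ->
  \int[density mf f0]_x h x = \int[mu]_x (h x * (f x)%:E).
Proof.
move=> mh h0; have mE : measurable_fun setT (EFin \o f) by exact/measurable_EFinP.
pose h_ := nnsfun_approx measurableT mh.
have ndh x : {homo (fun n => (h_ n x)%:E) : m n / (m <= n)%N >-> m <= n}.
  by move=> m n mn; rewrite lee_fin; exact/lefP/nd_nnsfun_approx.
have mh_ n : measurable_fun setT (fun x => (h_ n x)%:E).
  exact/measurable_EFinP/measurable_funP.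
have cvgh x : (h_ n x)%:E @[n --> \oo] --> h x by apply: cvg_nnsfun_approx.
transitivity (limn (fun n => \int[density mf f0]_x (h_ n x)%:E)).
  rewrite -monotone_convergence//.
  - by apply: eq_integral => x _; apply/esym/cvg_lim.
  by move=> n x _; rewrite lee_fin.
transitivity (limn (fun n => \int[mu]_x ((h_ n x)%:E * (f x)%:E))); last first.
  rewrite -monotone_convergence//.
  - apply: eq_integral => x _; apply/cvg_lim => //.
    by apply: cvgeZr.
  - by move=> n; exact: emeasurable_funM.
  - by move=> n x _; rewrite mule_ge0 // lee_fin.
  - by move=> x _ m n mn; rewrite lee_wpmul2r ?lee_fin// -lee_fin ndh.
congr (limn _); apply/funext => n.
have hE x : (h_ n x)%:E * (f x)%:E =
    \sum_(r \in range (h_ n)) ((r * \1_(h_ n @^-1` [set r]) x)%:E * (f x)%:E).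
  rewrite fimfunE -fsumEFin// ge0_mule_fsuml// => r.
  by rewrite EFinM nnfun_muleindic_ge0.
rewrite integralT_nnsfun sintegralE (eq_integral _ _ (fun x _ => hE x)).
rewrite ge0_integral_fsum//; first last.
- by move=> r x _; rewrite mule_ge0 ?lee_fin// -lee_fin EFinM nnfun_muleindic_ge0.
- move=> r; apply: emeasurable_funM => //.
  exact/measurable_EFinP/measurable_funM.
apply: eq_fsbigr => r /set_mem[y _ <-].
under [RHS]eq_integral do rewrite EFinM -muleA.
rewrite ge0_integralZl//; last 3 first.
- by apply: emeasurable_funM => //; exact/measurable_EFinP.
- by move=> x _; rewrite mule_ge0 ?lee_fin.
- by rewrite lee_fin.
congr (_ * _); rewrite /= /density integral_mkcond; apply: eq_integral => x _.
by rewrite patchE indicE; case: ifPn => _; rewrite ?mul1e ?mul0e.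
Qed.

End density.

(** * Substituting a square in one variable *)

Section square_substitution.
Context (R : realType).
Notation mu := (@lebesgue_measure R).

Lemma measurable_sqrt : measurable_fun setT (@Num.sqrt R).
Proof. apply: continuous_measurable_fun; exact: sqrt_continuous. Qed.

Lemma measurable_invsqrt : measurable_fun setT (fun x : R => (Num.sqrt x)^-1).
Proof.
(* For negative [x] the root is 0, and so is its inverse; cutting the base off at 0 gives the real
   power the same value. *)
rewrite (_ : (fun x => _) = fun x => (Num.max x 0) `^ (- 2^-1)).
  apply: (@measurableT_comp _ _ _ _ _ _ (fun y : R => y `^ (- 2^-1)) _
    (fun x : R => Num.max x 0)).
    exact: measurable_powR.
  exact: measurable_maxr.
apply/funext => x; rewrite powRN powR12_sqrt ?le_max ?lexx ?orbT//.
by case: (leP x 0) => // x0; rewrite sqrtr0 ler0_sqrtr.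
Qed.

Let sq (x : R) : R := x ^+ 2.
(** Derivative of squaring on the positive half-line and 0 elsewhere; as a density, it has the
    Lebesgue measure of the positive half-line as image under squaring. *)
Let posdbl (x : R) := 2 * Num.max x 0.

Let measurable_sq : measurable_fun setT sq.
Proof. exact: measurable_funX. Qed.

Let posdbl_ge0 x : 0 <= posdbl x.
Proof. by rewrite mulr_ge0// le_max lexx orbT. Qed.

Let measurable_posdbl : measurable_fun setT posdbl.
Proof. by apply: measurable_funM => //; exact: measurable_maxr. Qed.

Let pos : set R := `]0, +oo[%classic.

Let mpos : measurable_fun setT (\1_pos : R -> R).
Proof. by apply: measurable_indic; exact: measurable_itv. Qed.

Let pos_ge0 x : 0 <= (\1_pos : R -> R) x.
Proof. by rewrite indicE; case: (_ \in _). Qed.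

(** The fundamental theorem of calculus with primitive x^2; the maximum makes the right-hand
    interval empty when [b <= a], which covers that case too. *)
Let integral_dbl (a b : R) : 0 <= a ->
  (\int[mu]_(x in `]a, b]) (posdbl x)%:E)%E =
  mu `]a ^+ 2, (Num.max a b) ^+ 2].
Proof.
move=> a0; rewrite lebesgue_measure_itv/= lte_fin.
have [ab|ba] := ltP a b; last first.
  by rewrite ltxx set_itv_ge ?integral_set0// -leNgt bnd_simp.
rewrite ltr_pXn2r ?nnegrE ?(le_trans a0 (ltW ab))// ab.
rewrite -EFinB integral_itv_obnd_cbnd; last first.
  by apply: measurable_funTS; exact/measurable_EFinP.
transitivity (\int[mu]_(x in `[a, b]) (2 * x)%:E)%E.
  apply: eq_integral => x /[!inE]/=; rewrite in_itv/= => /andP[ax _].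
  by rewrite /posdbl max_l// (le_trans a0).
have cX : continuous (fun x : R => x ^+ 2) by exact: exprn_continuous.
apply: (@continuous_FTC2 _ _ (fun x : R => x ^+ 2)) => //.
- apply: continuous_subspaceT => x; exact: mulrl_continuous.
- split.
  + by move=> x _; exact: exprn_derivable.
  + by apply: cvg_at_right_filter; exact: cX.
  + by apply: cvg_at_left_filter; exact: cX.
- move=> x _; rewrite derive1E exp_derive /GRing.scale/= mulr1.
  by rewrite expr1 mulr_natl.
Qed.



Notation T := (measurableTypeR R).
Let m1 := @density _ T R mu _ mpos pos_ge0.
Let m2 := @density _ T R mu _ measurable_posdbl posdbl_ge0.

(** Half-open intervals are closed under intersection and generate the Borel sets, and the line is a
    union of countably many of them with finite measure: two measures that agree on them are
    equal. *)
Let pos_square (A : set T) : measurable A ->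
  m1 A = pushforward m2 (sq : T -> T) A.
Proof.
have msq : measurable_fun setT (sq : T -> T) by exact: measurable_sq.
refine (@measure_unique _ R T (@ocitv R)
  (fun k => `](- k%:R), k%:R]%classic) _ _ _ _ m1
  (measure_function_pushforward__canonical__measure_function_Measure _ msq)
  _ _ _); try by [].
- exact: (@ocitvI R).
- by move=> k; exact: is_ocitv.
- rewrite -subTset => x _; exists (Num.truncn `|x|).+1 => //=.
  rewrite in_itv/=; have := Num.Theory.truncnS_gt `|x|.
  by rewrite ltr_norml => /andP[-> /ltW].
- move=> X [[a b] _ <-] /=; rewrite /m1 /m2 /pushforward /density.
  (* [Num.sqrt] vanishes on negative reals, so the endpoints are the positive parts of [a] and of
     the larger of [a] and [b]. This is the part of []a, b]] in the positive half-line, for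
     endpoints of either sign, in the shape produced by [integral_dbl]. *)
  transitivity (mu `](Num.sqrt a) ^+ 2, (Num.max (Num.sqrt a) (Num.sqrt b)) ^+ 2]).
    rewrite integral_indic; [|exact: measurable_itv|exact: measurable_itv].
    congr (lebesgue_measure _); apply/seteqP.
    suff E x : pos x /\ `]a, b]%classic x <->
      `](Num.sqrt a) ^+ 2, (Num.max (Num.sqrt a) (Num.sqrt b)) ^+ 2]%classic x.
      by split=> x /E.
    have sqrtE (y : R) : Num.sqrt y ^+ 2 = Num.max y 0.
      have [y0|y0] := leP 0 y; first by rewrite sqr_sqrtr.
      by rewrite ltr0_sqrtr// expr0n.
    have -> : Num.max (Num.sqrt a) (Num.sqrt b) = Num.sqrt (Num.max a b).
      by have [ab|/ltW ab] := leP a b; [rewrite max_r|rewrite max_l];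
        rewrite ?ler_wsqrtr.
    rewrite !sqrtE /pos /= !in_itv/= andbT.
    case: (leP a b) => ab; case: (leP a 0) => ?; case: (leP b 0) => ?;
      rewrite ?(max_l, max_r)//; split => [[? /andP[? ?]]|/andP[? ?]];
      try split; try (apply/andP; split); try lra.
  transitivity (\int[mu]_(x in `]Num.sqrt a, Num.sqrt b]) (posdbl x)%:E)%E.
    exact/esym/integral_dbl/sqrtr_ge0.
  rewrite [RHS]integral_mkcond [LHS]integral_mkcond; apply: eq_integral => x _.
  have [x0|x0] := leP x 0.
    by rewrite !patchE /posdbl max_r// mulr0 !if_same.
  rewrite !patchE; congr (if _ then _ else _).
  have sqrtE : Num.sqrt (x ^+ 2) = x by rewrite sqrtr_sqr gtr0_norm.
  have ltE (c : R) : (Num.sqrt c < x) = (c < x ^+ 2).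
    by rewrite -{1}sqrtE ltr_sqrt// exprn_gt0.
  have leE (c : R) : (x <= Num.sqrt c) = (x ^+ 2 <= c) by rewrite !leNgt ltE.
  by apply/idP/idP; rewrite !inE/= !in_itv/= /sq ltE leE.
- move=> k; rewrite /m1 /= /density.
  rewrite integral_indic; [|exact: measurable_itv|exact: measurable_itv].
  apply: (@le_lt_trans _ _ (mu `](- k%:R), k%:R])); last first.
    by rewrite lebesgue_measure_itv/=; case: ifP => // _; rewrite -EFinD ltry.
  apply: le_measure; rewrite ?inE; [|exact: measurable_itv|by move=> ? []].
  by apply: measurableI; exact: measurable_itv.
Qed.

(** The integral folded onto the positive half-line is written over the whole line, where it can be
    compared pointwise with an integral against [posdbl]. *)
Lemma ge0_integral_even (h : R -> \bar R) :
  measurable_fun setT h -> (forall x, 0 <= h x)%E -> (forall x, h (- x) = h x) ->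
  (\int[mu]_x h x = \int[mu]_x (h x * (2 * \1_(`]0, +oo[ : set R) x)%:E))%E.
Proof.
move=> mh h0 hN.
have mS (D : set R) : measurable_fun D h by exact: measurable_funTS.
have mC : measurable (~` `[0%R, +oo[%classic : set R) by exact: measurableC.
transitivity (\int[mu]_(x in `]0%R, +oo[) h x + \int[mu]_(x in `]0%R, +oo[) h x)%E.
  rewrite -{1}(setUv `[0%R, +oo[%classic) ge0_integral_setU//=;
    [|exact: mS|exact/disj_setPCl].
  rewrite setCitvr integral_itv_bndo_bndc//.
  under [X in (_ + X)%E]eq_integral do rewrite -hN.
  by rewrite -ge0_integration_by_substitution0// -integral_itv_obnd_cbnd.
transitivity (\int[mu]_(x in `]0%R, +oo[) (2%:E * h x))%E.
  by rewrite ge0_integralZl//; [rewrite mule_natl mule2n|exact: mS].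
rewrite integral_mkcond; apply: eq_integral => x _.
by rewrite patchE indicE; case: ifPn; rewrite ?mulr1 ?mulr0 ?mule0// muleC.
Qed.

(** With x = s^2, the factor s of the Jacobian 2 s cancels the inverse root, and the remaining 2
    counts the two half-lines of the even function on the right. Negative [x] contribute nothing on
    the left, the inverse root being 0 there. *)
Lemma ge0_integral_square (h : R -> \bar R) :
  measurable_fun setT h -> (forall x, 0 <= h x)%E ->
  (\int[mu]_x (h x * ((Num.sqrt x)^-1)%:E))%E =
  (\int[mu]_x h (x ^+ 2)%R)%E.
Proof.
move=> mh h0.
set g := fun x => (h x * ((Num.sqrt x)^-1)%:E)%E.
have g0 x : (0 <= g x)%E by rewrite mule_ge0// lee_fin invr_ge0 sqrtr_ge0.
have mg : measurable_fun setT g.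
  by apply: emeasurable_funM => //; apply/measurable_EFinP; exact: measurable_invsqrt.
have msq : measurable_fun setT (sq : T -> T) by exact: measurable_sq.
have mgs : measurable_fun setT (g \o sq) by exact: measurableT_comp.
have mhs : measurable_fun setT (h \o sq) by exact: measurableT_comp.
transitivity (\int[m1]_x g x)%E.
  rewrite [RHS]ge0_integral_density//; apply: eq_integral => x _.
  rewrite indicE; case: (boolP (x \in _)); rewrite ?mule1//.
  rewrite notin_setE /pos/= in_itv/= andbT => /negP; rewrite -leNgt => x0.
  by rewrite /g ler0_sqrtr// invr0 mule0 mul0e.
transitivity (\int[pushforward m2 (sq : T -> T)]_x g x)%E.
  by apply: eq_measure_integral => A mA _; exact: pos_square.
rewrite ge0_integral_pushforward//.
rewrite [LHS]ge0_integral_density//; last first.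
  by move=> x; exact: g0.
rewrite [RHS]ge0_integral_even; last 3 first.
- exact: mhs.
- by [].
- by move=> x; rewrite sqrrN.
apply: eq_integral => x _; rewrite /= /g -muleA -EFinM; congr (_ * _%:E)%E.
rewrite /sq sqrtr_sqr /posdbl indicE mulrCA; congr (_ * _).
case: (boolP (x \in _)); rewrite ?notin_setE ?inE/= in_itv/= andbT.
  by move=> x0; rewrite max_l ?ltW// gtr0_norm// mulVf// gt_eqF.
by move=> /negP; rewrite -leNgt => x0; rewrite max_r// mulr0.
Qed.

End square_substitution.

(** * Squaring and reflecting coordinates in the plane *)

Section plane_substitution.
Context (R : realType).
Notation mu := (@lebesgue_measure R).
Notation T := (measurableTypeR R).
Local Open Scope ereal_scope.

Lemma ge0_integral_opp (h : R -> \bar R) :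
  measurable_fun setT h -> (forall x, 0 <= h x) ->
  \int[mu]_x h (- x)%R = \int[mu]_x h x.
Proof.
move=> mh h0; have mN : measurable_fun setT (-%R : T -> T) by exact: oppr_measurable.
rewrite -[LHS](@ge0_integral_pushforward _ _ _ _ _ _ mN mu setT h)//.
by apply: eq_measure_integral => A mA _; exact: lebesgue_measureN.
Qed.

Lemma measurable_fun_coordinates (f g : R -> R) :
  measurable_fun setT f -> measurable_fun setT g ->
  measurable_fun setT (fun z : T * T => (f z.1, g z.2) : T * T).
Proof.
move=> mf mg; apply: measurable_fun_pair.
- exact: (@measurableT_comp _ _ _ (T * T)%type T T f setT fst).
- exact: (@measurableT_comp _ _ _ (T * T)%type T T g setT snd).
Qed.

Lemma ge0_integral_leb2_flip (h : T * T -> \bar R) :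
  measurable_fun setT h -> (forall z, 0 <= h z) ->
  \int[leb2 R]_z h (- z.1, z.2)%R = \int[leb2 R]_z h z.
Proof.
move=> mh h0.
have mN : measurable_fun setT (-%R : R -> R) by exact: oppr_measurable.
rewrite [LHS](fubini_tonelli1 (fun z : T * T => h (- z.1, z.2)%R))//; last first.
  exact: (measurableT_comp mh (measurable_fun_coordinates mN (@measurable_id _ _ _))).
rewrite [RHS]fubini_tonelli1//.
rewrite -[RHS]ge0_integral_opp//; first by exact: measurable_fun_fubini_tonelli_F.
by move=> x; apply: integral_ge0.
Qed.

Lemma ge0_integral_leb2_square (h : T * T -> \bar R) :
  measurable_fun setT h -> (forall z, 0 <= h z) ->
  \int[leb2 R]_z (h z * ((Num.sqrt z.1)^-1 * (Num.sqrt z.2)^-1)%:E) =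
  \int[leb2 R]_z h (z.1 ^+ 2, z.2 ^+ 2)%R.
Proof.
move=> mh h0.
pose k (x : R) := (Num.sqrt x)^-1%R.
have k0 x : (0 <= k x)%R by rewrite invr_ge0 sqrtr_ge0.
have mk : measurable_fun setT k by exact: measurable_invsqrt.
have mid : measurable_fun setT (id : R -> R) by exact: measurable_id.
have msq : measurable_fun setT (fun x : R => x ^+ 2)%R by exact: measurable_funX.
(* The halfway function, squared in the second coordinate only: the one-variable substitution is
   applied to the inner integral, then to the outer one. *)
pose h2 (z : T * T) := h (z.1, z.2 ^+ 2)%R.
have mh2 : measurable_fun setT h2.
  exact: (measurableT_comp mh (measurable_fun_coordinates mid msq)).
have mhx x : measurable_fun setT (fun y : T => h (x, y)).
  exact: (measurableT_comp mh (pair1_measurable x)).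
have h20 z : 0 <= h2 z by exact: h0.
rewrite [LHS]fubini_tonelli1; last 2 first.
- apply: emeasurable_funM => //; apply/measurable_EFinP.
  apply: measurable_funM.
  + exact: (@measurableT_comp _ _ _ (T * T)%type T _ k setT fst).
  + exact: (@measurableT_comp _ _ _ (T * T)%type T _ k setT snd).
- by move=> z; rewrite mule_ge0// lee_fin mulr_ge0// ?k0.
rewrite [RHS](fubini_tonelli1 (fun z : T * T => h (z.1 ^+ 2, z.2 ^+ 2)%R))//; last first.
  exact: (measurableT_comp mh (measurable_fun_coordinates msq msq)).
transitivity (\int[mu]_x (fubini_F mu h2 x * (k x)%:E)).
  apply: eq_integral => x _; rewrite /fubini_F/=.
  under eq_integral do rewrite mulrC EFinM muleA.
  rewrite ge0_integralZr//; last 2 first.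
  - apply: emeasurable_funM => //; exact/measurable_EFinP.
  - by move=> y _; rewrite mule_ge0// lee_fin k0.
  congr (_ * _); exact: (ge0_integral_square (mhx x)).
rewrite ge0_integral_square//; first exact: measurable_fun_fubini_tonelli_F.
by move=> x; apply: integral_ge0.
Qed.

End plane_substitution.

(** * Integrals over the triangle as integrals over the disk *)

Section disk_triangle.
Context (R : realType).
Notation T := (measurableTypeR R).

Lemma measurable_coordinate1 : measurable_fun setT (fun z : T * T => z.1 : R).
Proof. exact: (@measurable_fst _ _ T T). Qed.

Lemma measurable_coordinate2 : measurable_fun setT (fun z : T * T => z.2 : R).
Proof. exact: (@measurable_snd _ _ T T). Qed.

Lemma measurable_invsqrtM :
  measurable_fun setT (fun z : T * T => (Num.sqrt (z.1 * z.2 : R))^-1).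
Proof.
apply: (@measurableT_comp _ _ _ (T * T)%type R R (fun x : R => (Num.sqrt x)^-1) setT
  (fun z => z.1 * z.2)); first exact: measurable_invsqrt.
apply: measurable_funM; first exact: measurable_coordinate1.
exact: measurable_coordinate2.
Qed.

Lemma measurable_disk : measurable (@disk R : set (T * T)).
Proof.
rewrite (_ : @disk R = setT `&`
  (fun z : T * T => z.1 ^+ 2 + z.2 ^+ 2 : R) @^-1` `]-oo, 1%R]).
  suff m : measurable_fun setT (fun z : T * T => z.1 ^+ 2 + z.2 ^+ 2 : R).
    by apply: m => //; exact: measurable_itv.
  apply: measurable_funD; apply: measurable_funX.
    exact: measurable_coordinate1.
  exact: measurable_coordinate2.
by rewrite setTI; apply/seteqP; split => z /=; rewrite /disk /= in_itv.
Qed.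

Lemma measurable_triangle : measurable (@triangle R : set (T * T)).
Proof.
rewrite (_ : @triangle R =
  (setT `&` (fun z : T * T => z.1 : R) @^-1` `[0%R, +oo[) `&`
  (setT `&` (fun z : T * T => z.2 : R) @^-1` `[0%R, +oo[) `&`
  (setT `&` (fun z : T * T => z.1 + z.2 : R) @^-1` `]-oo, 1%R])).
  suff m : measurable_fun setT (fun z : T * T => z.1 + z.2 : R).
    apply: measurableI; first apply: measurableI.
    - by apply: measurable_coordinate1 => //; exact: measurable_itv.
    - by apply: measurable_coordinate2 => //; exact: measurable_itv.
    - by apply: m => //; exact: measurable_itv.
  apply: measurable_funD.
    exact: measurable_coordinate1.
  exact: measurable_coordinate2.
rewrite !setTI; apply/seteqP; split => z /=; rewrite /triangle /= !in_itv/= !andbT.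
  by case.
by case=> -[].
Qed.

Lemma triangle_square (z : R * R) :
  triangle (z.1 ^+ 2, z.2 ^+ 2) <-> disk z.
Proof. by split=> [[]//|dz]; split; rewrite ?sqr_ge0. Qed.

(** Extension by zero reduces this to the whole plane, since the preimage of the triangle under
    squaring is the full disk. The root of the product splits into two roots because the coordinates
    are nonnegative on the triangle. *)
Lemma ge0_integral_triangle (F : T * T -> \bar R) :
  measurable_fun (@triangle R) F -> (forall z, triangle z -> (0 <= F z)%E) ->
  (\int[leb2 R]_(z in @triangle R) (F z * ((Num.sqrt (z.1 * z.2))^-1)%:E))%E =
  (\int[leb2 R]_(z in @disk R) F (z.1 ^+ 2, z.2 ^+ 2)%R)%E.
Proof.
move=> mF F0; rewrite [LHS]integral_mkcond [RHS]integral_mkcond.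
have mh : measurable_fun setT (F \_ (@triangle R)).
  by apply/(measurable_restrictT _ _).1 => //; exact: measurable_triangle.
have h0 z : (0 <= (F \_ (@triangle R)) z)%E.
  by rewrite patchE; case: ifPn => // /set_mem; exact: F0.
transitivity (\int[leb2 R]_z ((F \_ (@triangle R)) z *
    ((Num.sqrt z.1)^-1 * (Num.sqrt z.2)^-1)%:E))%E.
  apply: eq_integral => z _; rewrite !patchE; case: ifPn; last by rewrite mul0e.
  by move=> /set_mem[z1 _ _]; rewrite sqrtrM// invfM.
rewrite ge0_integral_leb2_square//; apply: eq_integral => z _; rewrite !patchE.
congr (if _ then _ else _); apply/idP/idP => /set_mem h; apply/mem_set;
  exact/triangle_square.
Qed.

(** Positive and negative parts have equal extended integrals on both sides, so the real integrals
    agree whether or not they converge. *)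
Lemma Rintegral_triangle (F : T * T -> R) :
  measurable_fun (@triangle R) F ->
  \int[leb2 R]_(z in @triangle R) (F z * (Num.sqrt (z.1 * z.2))^-1) =
  \int[leb2 R]_(z in @disk R) F (z.1 ^+ 2, z.2 ^+ 2).
Proof.
move=> mF; rewrite /Rintegral; congr fine.
have s0 (x : R) : 0 <= (Num.sqrt x)^-1 by rewrite invr_ge0 sqrtr_ge0.
have mE : measurable_fun (@triangle R) (EFin \o F) by exact/measurable_EFinP.
(* [f] and [g] are given up to pointwise equality, because a part of the product with the inverse
   root only becomes a product after this nonnegative factor is pulled out of a maximum. *)
have E (G : T * T -> \bar R) :
    measurable_fun (@triangle R) G -> (forall z, 0 <= G z)%E ->
    forall f g, (forall z, f z = G z * ((Num.sqrt (z.1 * z.2))^-1)%:E)%E ->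
      (forall z, g z = G (z.1 ^+ 2, z.2 ^+ 2)%R) ->
  (\int[leb2 R]_(z in @triangle R) f z = \int[leb2 R]_(z in @disk R) g z)%E.
  move=> mG G0 f g fE gE.
  have -> : f = (fun z => G z * ((Num.sqrt (z.1 * z.2))^-1)%:E)%E by exact/funext.
  have -> : g = (fun z => G (z.1 ^+ 2, z.2 ^+ 2)%R) by exact/funext.
  exact: ge0_integral_triangle.
rewrite [LHS]integralE [RHS]integralE; congr (_ - _)%E.
- apply: (E ((EFin \o F)^\+)%E) => [||z|z].
  + exact: measurable_funepos.
  + by move=> z; exact: funepos_ge0.
  + rewrite !funeposE/= muleC EFinM [X in maxe X]muleC.
    by rewrite maxe_pMr ?lee_fin// mule0.
  + by rewrite !funeposE.
- apply: (E ((EFin \o F)^\-)%E) => [||z|z].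
  + exact: measurable_funeneg.
  + by move=> z; exact: funeneg_ge0.
  + rewrite !funenegE/= muleC -mulNr EFinM [X in maxe X]muleC.
    by rewrite maxe_pMr ?lee_fin// mule0.
  + by rewrite !funenegE.
Qed.

Lemma integrable_triangle (F : T * T -> R) :
  measurable_fun (@triangle R) F ->
  (leb2 R).-integrable (@disk R) (fun z => (F (z.1 ^+ 2, z.2 ^+ 2))%:E) ->
  (leb2 R).-integrable (@triangle R)
    (fun z => (F z * (Num.sqrt (z.1 * z.2))^-1)%:E).
Proof.
move=> mF /integrableP[_ iF]; apply/integrableP; split.
  apply/measurable_EFinP; apply: measurable_funM => //; apply: measurable_funTS.
  exact: measurable_invsqrtM.
rewrite (_ : integral _ _ _ = \int[leb2 R]_(z in @triangle R)
    (`|(F z)%:E| * ((Num.sqrt (z.1 * z.2))^-1)%:E))%E; last first.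
  apply: eq_integral => z _.
  have k0 : 0 <= (Num.sqrt (z.1 * z.2))^-1 by rewrite invr_ge0 sqrtr_ge0.
  by rewrite /= normrM (ger0_norm k0).
rewrite ge0_integral_triangle//.
by apply: measurableT_comp => //; exact/measurable_EFinP.
Qed.

Lemma Rintegral_disk_flip (F : T * T -> R) :
  measurable_fun (@disk R) F ->
  \int[leb2 R]_(z in @disk R) F (- z.1, z.2) = \int[leb2 R]_(z in @disk R) F z.
Proof.
move=> mF; rewrite /Rintegral; congr fine.
have mE : measurable_fun (@disk R) (EFin \o F) by exact/measurable_EFinP.
have flip (G : T * T -> \bar R) :
    measurable_fun (@disk R) G -> (forall z, 0 <= G z)%E ->
  (\int[leb2 R]_(z in @disk R) G (- z.1, z.2)%R =
   \int[leb2 R]_(z in @disk R) G z)%E.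
  move=> mG G0; rewrite [LHS]integral_mkcond [RHS]integral_mkcond.
  rewrite -[RHS]ge0_integral_leb2_flip.
  - apply: eq_integral => z _; rewrite !patchE; congr (if _ then _ else _).
    by apply/idP/idP; rewrite !inE /disk/= sqrrN.
  - by apply/(measurable_restrictT _ _).1 => //; exact: measurable_disk.
  - by move=> z; rewrite patchE; case: ifPn.
rewrite [LHS]integralE [RHS]integralE; congr (_ - _)%E.
- rewrite -(flip ((EFin \o F)^\+)%E (measurable_funepos mE)).
    by apply: eq_integral => z _; rewrite !funeposE.
  by move=> z; exact: funepos_ge0.
- rewrite -(flip ((EFin \o F)^\-)%E (measurable_funeneg mE)).
    by apply: eq_integral => z _; rewrite !funenegE.
  by move=> z; exact: funeneg_ge0.
Qed.

End disk_triangle.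

(** * Bivariate polynomials *)

Section bivariate_polynomials.
Context (R : realType).
Implicit Types (p q : bpoly R) (m : multinom 2).
Notation ix := (ord0 : 'I_2).
Notation iy := (ord_max : 'I_2).

Definition bpmnm (a b : nat) : multinom 2 :=
  mnm_add (mnm_muln (mnm1 ix) a) (mnm_muln (mnm1 iy) b).

Lemma bpmnmE a b : (bpmnm a b ix = a) * (bpmnm a b iy = b).
Proof. by split; rewrite mnmDE !mulmnE !mnm1E /=; lia. Qed.

Lemma bpmnmP m a b : (bpmnm a b == m) = (m ix == a) && (m iy == b).
Proof.
apply/eqP/andP => [<-|[/eqP ma /eqP mb]]; first by rewrite !bpmnmE.
apply/mnmP => i; have [->|->] : i = ix \/ i = iy.
- by case: i => -[|[|//]] ?; [left|right]; apply/val_inj.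
- by rewrite bpmnmE.
- by rewrite bpmnmE.
Qed.

Lemma mdeg2E m : mdeg m = (m ix + m iy)%N.
Proof.
rewrite mdegE big_ord_recr big_ord_recr big_ord0/= add0n.
by congr (m _ + m _)%N; apply/val_inj.
Qed.

Lemma bpmonE a b : bpX R ^+ a * bpY R ^+ b = mpolyX R (bpmnm a b).
Proof. by rewrite !mpolyXn -mpolyXD. Qed.

Lemma mcoeff_bpmon m a b :
  mcoeff m (bpX R ^+ a * bpY R ^+ b) = ((m ix == a) && (m iy == b))%:R.
Proof. by rewrite bpmonE mcoeffX bpmnmP. Qed.

Lemma mpolyX_bpmon m : mpolyX R m = bpX R ^+ m ix * bpY R ^+ m iy.
Proof.
by apply/esym; rewrite bpmonE; congr mpolyX; apply/eqP; rewrite bpmnmP !eqxx.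
Qed.

Lemma mcoeff_msupp_sum m p :
  mcoeff m p = \sum_(k <- msupp p) mcoeff k p * (k == m)%:R.
Proof.
rewrite {1}[p]mpolyE raddf_sum; apply: eq_bigr => k _ /=.
by rewrite mcoeffZ mcoeffX.
Qed.

Lemma msize_leP p n :
  reflect (forall m, (n <= mdeg m)%N -> mcoeff m p = 0) (msize p <= n)%N.
Proof.
apply: (iffP idP) => [pn m nm|h].
  apply/eqP; rewrite mcoeff_eq0; apply: msize_mdeg_ge; exact: leq_trans nm.
rewrite msizeE; apply/bigmax_leqP_seq => m; rewrite mcoeff_msupp => + _.
by apply: contraNT; rewrite -ltnNge => /h ->.
Qed.

Lemma bpsqE p : bpsq p =
  \sum_(k <- msupp p) mcoeff k p *: (bpX R ^+ (k ix).*2 * bpY R ^+ (k iy).*2).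
Proof.
rewrite {1}[p]mpolyE /bpsq raddf_sum; apply: eq_bigr => k _ /=.
rewrite comp_mpolyZ comp_mpolyX big_ord_recr big_ord_recr big_ord0/= mul1r.
rewrite !(tnth_nth 0)/= -!exprM !mul2n.
by congr (_ *: (_ ^+ (k _).*2 * _ ^+ (k _).*2)); apply/val_inj.
Qed.

(** Exponents undergo the injective map sending (a, b) to (i + 2 a, j + 2 b), so coefficients are
    unchanged. This is how monicity passes from the disk to the triangle. *)
Lemma mcoeff_bpsq i j m p :
  mcoeff (bpmnm (i + (m ix).*2) (j + (m iy).*2))
    (bpX R ^+ i * bpY R ^+ j * bpsq p) = mcoeff m p.
Proof.
rewrite bpsqE mulr_sumr raddf_sum [RHS]mcoeff_msupp_sum; apply: eq_bigr => k _ /=.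
rewrite -scalerAr mcoeffZ; congr (_ * _).
rewrite mulrACA -!exprD mcoeff_bpmon !bpmnmE.
have -> : (k == m) = (bpmnm (k ix) (k iy) == m).
  by congr (_ == _); apply/esym/eqP; rewrite bpmnmP !eqxx.
by rewrite bpmnmP !eqn_add2l !(inj_eq double_inj) (eq_sym (m _)) (eq_sym (m _)).
Qed.

(** Reflecting x alone separates the summands: in each decomposition of [S], exactly one of them is
    odd in x. *)
Definition bpflip p : bpoly R := comp_mpoly [tuple - bpX R; bpY R] p.

Lemma bpflipE p : bpflip p =
  \sum_(k <- msupp p) mcoeff k p *: ((-1) ^+ k ix *: mpolyX R k).
Proof.
rewrite {1}[p]mpolyE /bpflip raddf_sum; apply: eq_bigr => k _ /=.
rewrite comp_mpolyZ comp_mpolyX big_ord_recr big_ord_recr big_ord0/= mul1r.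
rewrite !(tnth_nth 0)/= (mpolyX_bpmon k); congr (_ *: _).
rewrite scalerAl; congr (_ * _).
rewrite -scaleN1r exprZn; have -> // : widen_ord (leqnSn 1) ord_max = ix.
exact/val_inj.
Qed.

Lemma mcoeff_bpflip m p : mcoeff m (bpflip p) = (-1) ^+ (m ix) * mcoeff m p.
Proof.
rewrite bpflipE [in RHS]mcoeff_msupp_sum raddf_sum mulr_sumr.
apply: eq_bigr => k _; rewrite /= !mcoeffZ mcoeffX.
by case: eqP => [->|]; rewrite ?mulr0// !mulr1 mulrC.
Qed.

Lemma msize_bpflip p n : (msize p <= n)%N -> (msize (bpflip p) <= n)%N.
Proof.
move=> /msize_leP h; apply/msize_leP => m nm.
by rewrite mcoeff_bpflip h// mulr0.
Qed.

Lemma bpflipM p q : bpflip (p * q) = bpflip p * bpflip q.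
Proof. exact: rmorphM. Qed.

Lemma bpflipK p : bpflip (bpflip p) = p.
Proof.
apply/mpolyP => m; rewrite !mcoeff_bpflip mulrA -exprMn mulrNN mulr1 expr1n.
by rewrite mul1r.
Qed.

Lemma bpevalE p (z : R * R) : bpeval p z =
  \sum_(k <- msupp p) mcoeff k p * (z.1 ^+ k ix * z.2 ^+ k iy).
Proof.
rewrite /bpeval mevalE; apply: eq_bigr => k _; congr (_ * _).
rewrite big_ord_recr big_ord_recr big_ord0/= mul1r !(tnth_nth 0)/=.
by congr (_ ^+ k _ * _ ^+ k _); apply/val_inj.
Qed.

Lemma bpevalM p q z : bpeval (p * q) z = bpeval p z * bpeval q z.
Proof. exact: mevalM. Qed.

Lemma bpevalX z : bpeval (bpX R) z = z.1.
Proof. by rewrite /bpeval mevalXU. Qed.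

Lemma bpevalY z : bpeval (bpY R) z = z.2.
Proof. by rewrite /bpeval mevalXU. Qed.

Lemma bpeval_mon a b z : bpeval (bpX R ^+ a * bpY R ^+ b) z = z.1 ^+ a * z.2 ^+ b.
Proof.
rewrite bpevalM /bpeval !rmorphXn/= -/(bpeval _ z) -/(bpeval (bpY R) z).
by rewrite bpevalX bpevalY.
Qed.

Lemma bpeval_sq p z : bpeval (bpsq p) z = bpeval p (z.1 ^+ 2, z.2 ^+ 2).
Proof.
rewrite /bpeval /bpsq comp_mpoly_meval; apply: meval_eq => i.
have [->|->] : i = ix \/ i = iy.
- by case: i => -[|[|//]] ?; [left|right]; apply/val_inj.
- by rewrite !(tnth_nth 0)/= rmorphXn/= mevalXU.
- by rewrite !(tnth_nth 0)/= rmorphXn/= mevalXU.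
Qed.

Lemma bpeval_flip p z : bpeval (bpflip p) z = bpeval p (- z.1, z.2).
Proof.
rewrite /bpeval /bpflip comp_mpoly_meval; apply: meval_eq => i.
have [->|->] : i = ix \/ i = iy.
- by case: i => -[|[|//]] ?; [left|right]; apply/val_inj.
- by rewrite !(tnth_nth 0)/= mevalN mevalXU.
- by rewrite !(tnth_nth 0)/= mevalXU.
Qed.

End bivariate_polynomials.

(** * Integrals against the weights *)

Section weighted_integrals.
Context (R : realType) (W : R * R -> R).
Hypothesis hW : is_weight (@disk R) (diskW W).
Notation T := (measurableTypeR R).
Implicit Types p q : bpoly R.

Lemma measurable_bpeval p : measurable_fun setT (fun z : T * T => bpeval p z : R).
Proof.
rewrite (_ : (fun z => _) = fun z : T * T =>
    \sum_(k <- msupp p) mcoeff k p * ((z.1 : R) ^+ k ord0 * (z.2 : R) ^+ k ord_max)).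
  apply: measurable_sum => k; apply: measurable_funM => //.
  apply: measurable_funM; apply: measurable_funX.
    exact: measurable_coordinate1.
  exact: measurable_coordinate2.
by apply/funext => z; rewrite bpevalE.
Qed.

Lemma measurable_diskW : measurable_fun (@disk R) (diskW W : T * T -> R).
Proof.
apply/measurable_EFinP; have /integrableP[+ _] := weight_moments hW 0 0.
by under eq_fun do rewrite !expr0 !mul1r.
Qed.

Lemma weight00E z : triangle z ->
  weight00 (diskW W) z = (Num.sqrt (z.1 * z.2))^-1 * W z.
Proof.
move=> [z1 z2 _]; rewrite /weight00 /diskW/= !sqr_sqrtr//.
by case: z z1 z2.
Qed.

(** Measurability is known for [diskW W] on the disk; on the triangle [W] is its composite with the
    coordinatewise root, which maps the triangle into the disk. *)
Lemma measurable_triangle_weight : measurable_fun (@triangle R) (W : T * T -> R).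
Proof.
have m : measurable_fun (@triangle R)
    ((diskW W : T * T -> R) \o (fun z : T * T => (Num.sqrt z.1, Num.sqrt z.2) : T * T)).
  refine (@measurable_comp _ _ _ (T * T)%type (T * T)%type _ _ _ _ _
    (@measurable_disk R) _ measurable_diskW _).
    by move=> _ [z [z1 z2 z12] <-]; rewrite /disk/= !sqr_sqrtr.
  apply: measurable_funTS; apply: measurable_fun_coordinates; exact: measurable_sqrt.
apply: eq_measurable_fun m => z /set_mem[z1 z2 _]; rewrite /diskW/= !sqr_sqrtr//.
by case: z z1 z2.
Qed.

(** The moment functional of the disk weight; Gram entries are its values at products of
    polynomials. *)
Definition disk_form p : R := \int[leb2 R]_(z in @disk R) (bpeval p z * diskW W z).

Lemma integrable_disk_bpeval p :
  (leb2 R).-integrable (@disk R) (fun z => (bpeval p z * diskW W z)%:E).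
Proof.
rewrite (_ : (fun z => _) = fun z => (\sum_(k <- msupp p) (mcoeff k p)%:E *
    (z.1 ^+ k ord0 * z.2 ^+ k ord_max * diskW W z)%:E)%E).
  apply: integrable_sum; first exact: measurable_disk.
  move=> k _; apply: integrableZl; first exact: measurable_disk.
  exact: weight_moments hW _ _.
apply/funext => z; rewrite bpevalE mulr_suml -sumEFin; apply: eq_bigr => k _.
by rewrite -EFinM -!mulrA.
Qed.

Lemma disk_formD p q : disk_form (p + q) = disk_form p + disk_form q.
Proof.
rewrite /disk_form -RintegralD; [|exact: measurable_disk|exact: integrable_disk_bpeval..].
by apply: eq_Rintegral => z _; rewrite /bpeval mevalD mulrDl.
Qed.

Lemma disk_formZ c p : disk_form (c *: p) = c * disk_form p.
Proof.
rewrite /disk_form -RintegralZl; [|exact: measurable_disk|exact: integrable_disk_bpeval].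
by apply: eq_Rintegral => z _; rewrite /bpeval mevalZ mulrA.
Qed.

Lemma disk_form_sum (I : Type) (r : seq I) (c : I -> R) (F : I -> bpoly R) :
  disk_form (\sum_(i <- r) c i *: F i) = \sum_(i <- r) c i * disk_form (F i).
Proof.
elim: r => [|i r IH]; last by rewrite !big_cons disk_formD disk_formZ IH.
by rewrite !big_nil -(scale0r 0) disk_formZ mul0r.
Qed.

Lemma disk_form_flip p : disk_form (bpflip p) = disk_form p.
Proof.
rewrite /disk_form -[RHS]Rintegral_disk_flip.
  by apply: eq_Rintegral => z _; rewrite bpeval_flip /diskW/= sqrrN.
apply: measurable_funM; last exact: measurable_diskW.
apply: measurable_funTS; exact: measurable_bpeval.
Qed.

(** Exponents 0 and 1 give the four weights of the theorem, so that one argument serves them all. *)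
Definition triangleW (i j : nat) (z : R * R) : R :=
  z.1 ^+ i * z.2 ^+ j * weight00 (diskW W) z.

Let measurable_bpeval_weight p :
  measurable_fun (@triangle R) (fun z : T * T => bpeval p z * W z : R).
Proof.
apply: measurable_funM; last exact: measurable_triangle_weight.
apply: measurable_funTS; exact: measurable_bpeval.
Qed.

Let triangleWE i j p z : triangle z -> bpeval p z * triangleW i j z =
  bpeval (bpX R ^+ i * bpY R ^+ j * p) z * W z * (Num.sqrt (z.1 * z.2))^-1.
Proof.
move=> tz; rewrite /triangleW weight00E// bpevalM bpeval_mon; ring.
Qed.

Lemma bpsq_mon i j : bpsq (bpX R ^+ i * bpY R ^+ j) = (bpX R ^+ i * bpY R ^+ j) ^+ 2.
Proof.
rewrite /bpsq rmorphM !rmorphXn/= !comp_mpolyXU/=.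
by rewrite [RHS]exprMn -!exprM !(mulnC 2).
Qed.

(** The factor x^i y^j of the weight turns into its own square, which can be shared evenly between
    the two polynomials of a Gram entry. *)
Lemma triangle_form i j p :
  \int[leb2 R]_(z in @triangle R) (bpeval p z * triangleW i j z) =
  disk_form ((bpX R ^+ i * bpY R ^+ j) ^+ 2 * bpsq p).
Proof.
under eq_Rintegral => z /set_mem tz do rewrite triangleWE//.
rewrite Rintegral_triangle//; apply: eq_Rintegral => z _.
by rewrite -bpsq_mon -bpeval_sq /bpsq rmorphM.
Qed.

Lemma integrable_triangle_bpeval i j p :
  (leb2 R).-integrable (@triangle R) (fun z => (bpeval p z * triangleW i j z)%:E).
Proof.
apply: (@eq_integrable _ _ _ _ _ (@measurable_triangle R) (fun z =>
    (bpeval (bpX R ^+ i * bpY R ^+ j * p) z * W z * (Num.sqrt (z.1 * z.2))^-1)%:E)).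
  by move=> z /set_mem tz; rewrite triangleWE.
apply: integrable_triangle => //.
apply: (@eq_integrable _ _ _ _ _ (@measurable_disk R) (fun z =>
    (bpeval (bpsq (bpX R ^+ i * bpY R ^+ j * p)) z * diskW W z)%:E)).
  by move=> z _; rewrite bpeval_sq.
exact: integrable_disk_bpeval.
Qed.

(** Null sets are transferred through integrals: the negative part of [diskW W] has integral 0 over
    the disk, hence that of [W] times the inverse root has integral 0 over the triangle and vanishes
    almost everywhere. *)
Lemma triangleW_ge0 i j :
  {ae leb2 R, forall z, triangle z -> 0 <= triangleW i j z}.
Proof.
have aeF : Filter (almost_everywhere (leb2 R)) by exact: ae_filter_ringOfSetsType.
pose F (z : T * T) : \bar R := ((EFin \o (W : T * T -> R))^\- z)%E.
have mF : measurable_fun (@triangle R) F.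
  by apply: measurable_funeneg; apply/measurable_EFinP; exact: measurable_triangle_weight.
have F0 z : (0 <= F z)%E by exact: funeneg_ge0.
pose k (z : T * T) := (Num.sqrt (z.1 * z.2 : R))^-1.
have k0 z : 0 <= k z by rewrite invr_ge0 sqrtr_ge0.
have mFk : measurable_fun (@triangle R) (fun z => F z * (k z)%:E)%E.
  apply: emeasurable_funM => //; apply/measurable_EFinP.
  apply: measurable_funTS; exact: measurable_invsqrtM.
have FB : (\int[leb2 R]_(z in @disk R) F (z.1 ^+ 2, z.2 ^+ 2)%R = 0)%E.
  rewrite (_ : (fun z => _) = (EFin \o (diskW W : T * T -> R))^\-)%E; last first.
    by apply/funext => z; rewrite /F !funenegE.
  rewrite -[RHS](@integral0 _ _ _ (leb2 R) (@disk R)).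
  apply: ge0_ae_eq_integral => //.
  - exact: measurable_disk.
  - by apply: measurable_funeneg; apply/measurable_EFinP; exact: measurable_diskW.
  - refine (@filterS _ _ aeF _ _ _ (weight_ge0 hW)) => z h dz.
    by rewrite funenegE; apply/max_idPr; rewrite leeNl oppe0 lee_fin h.
have /(ae_eq_integral_abs _ (@measurable_triangle R) mFk) : 
    (\int[leb2 R]_(z in @triangle R) `|F z * (k z)%:E| = 0)%E.
  rewrite -FB -(ge0_integral_triangle mF (fun z _ => F0 z)).
  apply: eq_integral => z _; rewrite gee0_abs// mule_ge0// ?F0// lee_fin; exact: k0.
move=> ae0; refine (@filterS _ _ aeF _ _ _ ae0) => z h tz.
have := h tz; case: (tz) => z1 z2 _.
(* A vanishing product leaves two cases: [W z] has no negative part, or the inverse root is 0, so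
   that [z] lies on an axis and the weight is 0 by convention. *)
rewrite /triangleW weight00E// => /eqP; rewrite /cst mule_eq0 => /orP[|] /eqP Fz.
  rewrite !mulr_ge0 ?exprn_ge0// ?k0//.
  rewrite leNgt; apply/negP => Wz.
  move: Fz; rewrite /F funenegE/= max_l; last by rewrite lee_fin oppr_ge0 ltW.
  by move=> [/eqP]; rewrite oppr_eq0 lt_eqF.
by case: Fz; rewrite /k => ->; rewrite mul0r mulr0.
Qed.

End weighted_integrals.

(** * Monic orthogonal systems *)

Section monic_systems.
Context (R : realType) (P : polyvecs R).
Hypothesis hP : is_monic P.

(** Both the leading form in degree [n] and the absence of higher terms are contained here, since
    the right-hand side vanishes when [mdeg m] exceeds [n]. *)
Lemma monic_mcoeff n (j : 'I_n.+1) m : (n <= mdeg m)%N ->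
  mcoeff m (P n j 0) = ((m ord0 == n - j)%N && (m ord_max == j :> nat))%:R.
Proof.
move=> /(msize_leP _ _ (hP j)); rewrite mcoeffB mcoeff_bpmon => /eqP.
by rewrite subr_eq0 => /eqP.
Qed.

Lemma lincombS N c : lincomb P N.+1 c =
  lincomb P N c + \sum_(j < N.+1) c N j *: P N j 0.
Proof. by rewrite /lincomb big_ord_recr. Qed.

Lemma mcoeff_lincomb_lt N c m : (N <= mdeg m)%N -> mcoeff m (lincomb P N c) = 0.
Proof.
move=> Nm; rewrite /lincomb raddf_sum big1// => n _ /=.
rewrite raddf_sum big1// => j _ /=.
rewrite mcoeffZ monic_mcoeff ?(leq_trans _ Nm)// 1?ltnW//.
rewrite (_ : _ && _ = false) ?mulr0//; apply/negP => /andP[/eqP m0 /eqP m1].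
by move: Nm; rewrite mdeg2E m0 m1; have := ltn_ord n; have := ltn_ord j; lia.
Qed.

(** In degree [N] the entries [P N j 0] reduce to distinct monomials, so the coefficients of a
    combination can be read off; existence and uniqueness of expansions both rest on this. *)
Lemma mcoeff_top (c : nat -> R) N m : mdeg m = N ->
  mcoeff m (\sum_(j < N.+1) c j *: P N j 0) = c (m ord_max).
Proof.
move=> mN; have mE := mdeg2E m.
have lt : (m ord_max < N.+1)%N by lia.
rewrite raddf_sum (bigD1 (Ordinal lt))//= big1 ?addr0.
  rewrite mcoeffZ monic_mcoeff ?mN//= eqxx andbT (_ : _ == _) ?mulr1//.
  by apply/eqP; lia.
move=> i iN; rewrite mcoeffZ monic_mcoeff ?mN//.
rewrite (_ : _ && _ = false) ?mulr0//; apply/negP => /andP[_ /eqP mi].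
by move/eqP: iN; apply; apply/val_inj => /=.
Qed.

(** The explicit bound [N] on the indices is what orthogonality to polynomials of lower degree
    relies on later. *)
Lemma monic_span N q : (msize q <= N)%N -> exists c, q = lincomb P N c.
Proof.
elim: N q => [|N IH] q qN.
  exists (fun _ _ => 0); rewrite /lincomb big_ord0.
  by apply/eqP; rewrite -msize_poly_eq0 -leqn0.
pose c j := mcoeff (bpmnm (N - j) j) q.
have [|d dE] := IH (q - \sum_(j < N.+1) c j *: P N j 0).
  apply/msize_leP => m; rewrite leq_eqVlt => /predU1P[Nm|Nm].
    rewrite mcoeffB mcoeff_top// /c (_ : bpmnm _ _ = m) ?subrr//.
    by apply/eqP; rewrite bpmnmP eqxx andbT; apply/eqP; have := mdeg2E m; lia.
  rewrite mcoeffB (msize_leP _ _ qN)// sub0r; apply/eqP; rewrite oppr_eq0; apply/eqP.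
  rewrite raddf_sum big1// => j _ /=; rewrite mcoeffZ monic_mcoeff; last exact: ltnW.
  rewrite (_ : _ && _ = false) ?mulr0//; apply/negP => /andP[/eqP m0 /eqP m1].
  by move: Nm; rewrite mdeg2E m0 m1; have := ltn_ord j; lia.
exists (fun n j => if n == N then c j else d n j).
rewrite lincombS eqxx -[LHS](subrK (\sum_(j < N.+1) c j *: P N j 0)) dE.
congr (_ + _); apply: eq_bigr => n _; apply: eq_bigr => j _.
by rewrite ltn_eqF.
Qed.

Lemma lincomb_free N c : lincomb P N c = 0 ->
  forall n j : nat, (j <= n < N)%N -> c n j = 0.
Proof.
elim: N => [|N IH] PN n j; first by rewrite ltn0 andbF.
have top k : (k <= N)%N -> c N k = 0.
  move=> kN; have mN : mdeg (bpmnm (N - k) k) = N by rewrite mdeg2E !bpmnmE; lia.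
  have := congr1 (mcoeff (bpmnm (N - k) k)) PN.
  rewrite lincombS mcoeffD mcoeff_lincomb_lt ?mN// add0r mcoeff_top// mcoeff0.
  by rewrite bpmnmE.
move=> /andP[jn]; rewrite ltnS leq_eqVlt => /predU1P[nN|nN].
  by rewrite nN top// -nN.
apply: IH; rewrite ?jn//; move: PN; rewrite lincombS [X in _ + X]big1 ?addr0//.
by move=> i _; rewrite top ?scale0r// -ltnS.
Qed.

Lemma msize_monic n (j : 'I_n.+1) : msize (P n j 0) = n.+1.
Proof.
apply/eqP; rewrite eqn_leq; apply/andP; split.
  apply/msize_leP => m nm; rewrite (monic_mcoeff _ (ltnW nm)).
  rewrite (_ : _ && _ = false)//; apply/negP => /andP[/eqP m0 /eqP m1].
  by move: nm; rewrite mdeg2E m0 m1; have := ltn_ord j; lia.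
rewrite ltnNge; apply/negP => /msize_leP/(_ (bpmnm (n - j) j)).
have dE : mdeg (bpmnm (n - j) j) = n.
  by rewrite mdeg2E !bpmnmE; have := ltn_ord j; lia.
rewrite dE leqnn => /(_ isT); rewrite monic_mcoeff ?dE// !bpmnmE !eqxx.
by move/eqP; rewrite oner_eq0.
Qed.

Lemma monic_polysystem : is_polysystem P.
Proof.
split; [exact: msize_monic|exact: lincomb_free|move=> q].
by have [c ->] := monic_span (leqnn (msize q)); exists (msize q), c.
Qed.

End monic_systems.

(** * Orthogonality, definiteness and parity on the disk *)

Section disk_system.
Context (R : realType) (W : R * R -> R).
Hypothesis hW : is_weight (@disk R) (diskW W).
Variable S : polyvecs R.
Hypothesis hS : monic_OPS (@disk R) (diskW W) S.
Notation L := (disk_form W).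

Let comb n (v : 'cV[R]_n.+1) := \sum_(i < n.+1) v i 0 *: S n i 0.

Lemma gram_diskE n m i j :
  gram (@disk R) (diskW W) S n m i j = L (S n i 0 * S m j 0).
Proof. by rewrite mxE !mxE big_ord1 !mxE. Qed.

Let comb_form n m (v : 'cV_n.+1) (w : 'cV_m.+1) :
  L (comb v * comb w) = (v^T *m gram (@disk R) (diskW W) S n m *m w) 0 0.
Proof.
rewrite mxE.
have -> : comb v * comb w = \sum_(j < m.+1) w j 0 *: (comb v * S m j 0).
  by rewrite [comb w]/comb mulr_sumr; apply: eq_bigr => j _; rewrite scalerAr.
rewrite (disk_form_sum hW); apply: eq_bigr => j _; rewrite mulrC; congr (_ * _).
rewrite mxE.
have -> : comb v * S m j 0 = \sum_(i < n.+1) v i 0 *: (S n i 0 * S m j 0).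
  by rewrite /comb mulr_suml; apply: eq_bigr => i _; rewrite scalerAl.
rewrite (disk_form_sum hW); apply: eq_bigr => i _.
by rewrite gram_diskE mxE.
Qed.

Let lincomb_comb N c :
  lincomb S N c = \sum_(n < N) comb (\col_(j < n.+1) c n j).
Proof. by apply: eq_bigr => n _; apply: eq_bigr => j _; rewrite mxE. Qed.

Let L_sum (I : Type) (r : seq I) (F : I -> bpoly R) :
  L (\sum_(i <- r) F i) = \sum_(i <- r) L (F i).
Proof.
have -> : \sum_(i <- r) F i = \sum_(i <- r) 1 *: F i.
  by apply: eq_bigr => i _; rewrite scale1r.
by rewrite (disk_form_sum hW); apply: eq_bigr => i _; rewrite mul1r.
Qed.

Let comb_delta n (i : 'I_n.+1) : S n i 0 = comb (delta_mx i 0).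
Proof.
rewrite /comb (bigD1 i)//= big1 ?addr0 => [|j ji]; rewrite mxE ?eqxx ?scale1r//.
by rewrite (negbTE ji) scale0r.
Qed.

Lemma disk_form_orthogonal n (i : 'I_n.+1) q :
  (msize q <= n)%N -> L (S n i 0 * q) = 0.
Proof.
move=> /(monic_span (OPS_monic hS))[c ->].
rewrite lincomb_comb mulr_sumr L_sum big1// => m _.
rewrite comb_delta comb_form (OPS_orthogonal hS) ?mulmx0 ?mul0mx ?mxE//.
by rewrite gtn_eqF.
Qed.

(** By orthogonality, pairing [p] with its own component of index [m] isolates one diagonal Gram
    block; this block is positive definite, so a zero pairing forces the component to vanish. *)
Lemma disk_form_definite n p : (msize p <= n)%N ->
  (forall q, (msize q <= n)%N -> L (p * q) = 0) -> p = 0.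
Proof.
move=> pn hp; have [c pE] := monic_span (OPS_monic hS) pn.
suff c0 (m : 'I_n) : \col_(j < m.+1) c m j = 0.
  rewrite pE lincomb_comb big1// => m _; rewrite c0 /comb big1// => j _.
  by rewrite mxE scale0r.
set v := \col__ _; apply/eqP; apply/negPn/negP => v0.
have := (OPS_posdef hS m).2 v v0; rewrite -comb_form.
have <- : L (p * comb v) = L (comb v * comb v).
  rewrite pE lincomb_comb mulr_suml L_sum (bigD1 m)//= big1 ?addr0// => k km.
  by rewrite comb_form (OPS_orthogonal hS)// mulmx0 mul0mx mxE.
rewrite hp ?ltxx//; apply/msize_leP => k nk; rewrite raddf_sum big1// => j _ /=.
rewrite mcoeffZ; have /msize_leP -> // := eq_leq (msize_monic (OPS_monic hS) j).
  by rewrite mulr0.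
exact: leq_trans nk.
Qed.

Lemma OPS_parity n (k : 'I_n.+1) :
  bpflip (S n k 0) = (-1) ^+ (n - k) *: S n k 0.
Proof.
set D := S n k 0 - (-1) ^+ (n - k) *: bpflip (S n k 0).
suff D0 : D = 0.
  by rewrite {2}(subr0_eq D0) scalerA -exprD addnn -signr_odd odd_double scale1r.
apply: (@disk_form_definite n) => [|q qn].
  apply/msize_leP => m nm; rewrite mcoeffB mcoeffZ mcoeff_bpflip.
  rewrite (monic_mcoeff (OPS_monic hS))//.
  case: eqP => [->|_] /=; last by rewrite !mulr0 subr0.
  by rewrite mulrA -exprD addnn -signr_odd odd_double mul1r subrr.
rewrite /D mulrBl -scalerAl -scaleNr (disk_formD hW) (disk_formZ hW).
(* The reflection moves from [S n k 0] to [q]: it is an involution under which the form is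
   invariant, and it does not raise the degree of [q]. *)
rewrite disk_form_orthogonal// -{1}(bpflipK q) -bpflipM (disk_form_flip hW).
by rewrite disk_form_orthogonal ?mulr0 ?addr0//; exact: msize_bpflip.
Qed.

End disk_system.

(** The quadratic form is restricted to a subspace: [J] extends a vector by zero outside the range
    of [f], and injectivity of [f] keeps nonzero vectors nonzero. *)
Lemma sym_posdef_mxsub (R : realType) k l (f : 'I_k -> 'I_l) (A : 'M[R]_l) :
  injective f -> sym_posdef A -> sym_posdef (mxsub f f A).
Proof.
move=> finj [symA posA]; split.
  by apply/matrixP => a b; rewrite !mxE -[in LHS]symA mxE.
pose J : 'M[R]_(l, k) := \matrix_(a, b) (a == f b)%:R.
have JE : mxsub f f A = J^T *m A *m J.
  apply/matrixP => a b; rewrite !mxE (bigD1 (f b))//= big1 ?addr0; last first.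
    by move=> c cb; rewrite [J _ _]mxE (negbTE cb) mulr0.
  rewrite [J _ _]mxE eqxx mulr1 mxE (bigD1 (f a))//= big1 ?addr0; last first.
    by move=> c ca; rewrite !mxE (negbTE ca) mul0r.
  by rewrite !mxE eqxx mul1r.
move=> v v0; rewrite JE !mulmxA -trmx_mul -mulmxA; apply: posA.
apply: contra_neq v0 => Jv; apply/matrixP => a b; rewrite ord1 mxE.
have /matrixP/(_ (f a) 0) := Jv; rewrite !mxE (bigD1 a)//= big1 ?addr0.
  by rewrite mxE eqxx mul1r.
by move=> c ca; rewrite mxE (inj_eq finj) eq_sym (negbTE ca) mul0r.
Qed.

(** * Transfer of orthogonal systems from the disk to the triangle *)

Section triangle_system.
Context (R : realType) (W : R * R -> R).
Hypothesis hW : is_weight (@disk R) (diskW W).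
Variable S : polyvecs R.
Hypothesis hS : monic_OPS (@disk R) (diskW W) S.

(** The indices come from leading monomials: x^(n-h) y^h becomes x^(2n-2h+i) y^(2h+j), the leading
    monomial of the entry [h.*2 + j] in degree [n.*2 + i + j]. All parts of the theorem are
    instances. *)
Lemma triangle_OPS i j (Q : polyvecs R) :
  (forall n (h : 'I_n.+1), bpX R ^+ i * bpY R ^+ j * bpsq (Q n h 0) =
     S (n.*2 + i + j)%N (inord (h.*2 + j)) 0) ->
  monic_OPS (@triangle R) (triangleW W i j) Q.
Proof.
move=> hQ; pose f n (h : 'I_n.+1) : 'I_(n.*2 + i + j).+1 := inord (h.*2 + j).
have fE n (h : 'I_n.+1) : f n h = (h.*2 + j)%N :> nat.
  by rewrite /f inordK//; have := ltn_ord h; lia.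
have finj n : injective (f n).
  by move=> a b /(congr1 val); rewrite /= !fE => ?; apply/val_inj => /=; lia.
have gramE n m : gram (@triangle R) (triangleW W i j) Q n m =
    mxsub (f n) (f m) (gram (@disk R) (diskW W) S (n.*2 + i + j) (m.*2 + i + j)).
  apply/matrixP => a b; rewrite [RHS]mxE gram_diskE mxE triangle_form//.
  congr disk_form; rewrite -!hQ mxE big_ord1 mxE /bpsq rmorphM; ring.
have monicQ : is_monic Q.
  move=> n h; apply/msize_leP => m nm; rewrite mcoeffB mcoeff_bpmon.
  rewrite -(mcoeff_bpsq i j) hQ (monic_mcoeff (OPS_monic hS)); last first.
    by move: nm; rewrite !mdeg2E !bpmnmE; lia.
  rewrite !bpmnmE -[inord _]/(f n h) fE; apply/eqP; rewrite subr_eq0; apply/eqP.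
  congr ((nat_of_bool _)%:R); have := ltn_ord h => hn.
  by apply/idP/idP => /andP[/eqP ? /eqP ?]; apply/andP; split; apply/eqP; lia.
have posQ n : sym_posdef (gram (@triangle R) (triangleW W i j) Q n n).
  by rewrite gramE; apply: sym_posdef_mxsub; [exact: finj|exact: OPS_posdef hS _].
split => //; last 2 first.
- exact: monic_polysystem.
- move=> n m nm; rewrite gramE (OPS_orthogonal hS)//; last by lia.
  by apply/matrixP => a b; rewrite !mxE.
(* Since this entry is 1, the total mass of the weight is the only entry of the Gram matrix of index
   0, and its positivity is positive definiteness tested on the vector 1. *)
have Q0 : Q 0%N 0 0 = 1.
  apply/eqP; rewrite -subr_eq0 -msize_poly_eq0 -leqn0.
  by have := monicQ 0%N 0; rewrite subn0 !expr0 mulr1.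
split; first exact: triangleW_ge0.
- have := (posQ 0%N).2 (const_mx 1).
  rewrite !mxE big_ord1 !mxE big_ord1 !mxE mul1r mulr1 big_ord1 !mxE Q0 mulr1.
  under eq_Rintegral do rewrite /bpeval meval1 mul1r.
  apply; apply/negP => /eqP/matrixP/(_ 0 0); rewrite !mxE => /eqP.
  by rewrite oner_eq0.
- move=> h k; have := integrable_triangle_bpeval hW i j (bpX R ^+ h * bpY R ^+ k).
  by under eq_fun do rewrite bpeval_mon.
Qed.

(** The summand of the wrong parity equals its own negative, hence vanishes in characteristic 0. *)
Lemma OPS_parity_part n (k : 'I_n.+1) p q :
  bpflip p = p -> bpflip q = - q -> S n k 0 = p + q ->
  S n k 0 = if odd (n - k) then q else p.
Proof.
move=> pE qE SE; have := OPS_parity hW hS k.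
rewrite SE [bpflip _]rmorphD/= -/(bpflip p) -/(bpflip q) pE qE -signr_odd.
have two r : r = - r -> r = 0 :> bpoly R.
  move=> /eqP; rewrite -addr_eq0 -mulr2n -scaler_nat scaler_eq0 pnatr_eq0/=.
  by move/eqP.
case: (odd _); rewrite ?expr1 ?expr0 ?scaleN1r ?scale1r => E.
  rewrite [X in X + _]two ?add0r//; apply: (addIr (- q)).
  by rewrite E; ring.
rewrite [X in _ + X]two ?addr0//; apply/esym/(addrI p); exact: E.
Qed.

End triangle_system.

(** * Entries of the big vectors and the theorem *)

Lemma bpflip_sq (R : realType) (p : bpoly R) : bpflip (bpsq p) = bpsq p.
Proof.
rewrite !bpsqE [LHS]raddf_sum; apply: eq_bigr => k _ /=.
rewrite comp_mpolyZ; congr (_ *: _); rewrite rmorphM !rmorphXn/= !comp_mpolyXU/=.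
by rewrite -mul2n exprM sqrrN -exprM.
Qed.

Lemma bpflipX (R : realType) : bpflip (bpX R) = - bpX R.
Proof. by rewrite /bpflip comp_mpolyXU. Qed.

Lemma bpflipY (R : realType) : bpflip (bpY R) = bpY R.
Proof. by rewrite /bpflip comp_mpolyXU. Qed.

Lemma Jmx_mul (R : realType) (i j n : nat) (v : 'cV[bpoly R]_(i + j + n.*2.+1))
    (h : 'I_n.+1) (l : 'I_(i + j + n.*2.+1)) :
  l = (h.*2 + j)%N :> nat -> (Jmx R i j n *m v) h 0 = v l 0.
Proof.
move=> lE; rewrite mxE (bigD1 l)//= big1 ?addr0 => [|k kl]; rewrite mxE.
  by rewrite lE eqxx mul1r.
rewrite -lE (_ : _ == _ = false) ?mul0r//; apply/negP => /eqP kE.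
by move/eqP: kl; apply; apply/val_inj.
Qed.

Theorem mainTheorem6 (R : realType) (W : R * R -> R)
    (hW : is_weight (@disk R) (diskW W))
    (S : polyvecs R) (hS : monic_OPS (@disk R) (diskW W) S)
    (P00 : bigvecs R 0 0) (P10 : bigvecs R 1 0)
    (P01 : bigvecs R 0 1) (P11 : bigvecs R 1 1)
    (* the case n = 0 of the even decomposition, where P11_{-1} = 0 *)
    (hS0 : S 0%N = map_mx (@bpsq R) (P00 0%N))
    (hSeven : forall n : nat, S n.+1.*2 =
       map_mx (@bpsq R) (P00 n.+1)
       + (bpX R * bpY R) *: map_mx (@bpsq R) (P11 n))
    (hSodd : forall n : nat, S n.*2.+1 =
       bpX R *: map_mx (@bpsq R) (P10 n) + bpY R *: map_mx (@bpsq R) (P01 n)) :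
  [/\ monic_OPS (@triangle R) (weight00 (diskW W))
        (fun n => Jmx R 0 0 n *m P00 n),
      monic_OPS (@triangle R) (fun z => z.1 * weight00 (diskW W) z)
        (fun n => Jmx R 1 0 n *m P10 n),
      monic_OPS (@triangle R) (fun z => z.2 * weight00 (diskW W) z)
        (fun n => Jmx R 0 1 n *m P01 n)
    & monic_OPS (@triangle R) (fun z => z.1 * z.2 * weight00 (diskW W) z)
        (fun n => Jmx R 1 1 n *m P11 n)].
Proof.
(* When [N] and [M] are only provably equal, [S N] and [S M] have different types; writing indices
   with [inord] makes the entries comparable. *)
have Scast N M a : N = M -> S N (inord a) 0 = S M (inord a) 0 by move=> ->.
have flipXY p : bpflip (bpX R * bpY R * bpsq p) = - (bpX R * bpY R * bpsq p).
  by rewrite !bpflipM bpflipX bpflipY bpflip_sq; ring.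
have flipX p : bpflip (bpX R * bpsq p) = - (bpX R * bpsq p).
  by rewrite bpflipM bpflipX bpflip_sq; ring.
have flipY p : bpflip (bpY R * bpsq p) = bpY R * bpsq p.
  by rewrite bpflipM bpflipY bpflip_sq.
have evenE n (k : 'I_(n.+1.*2).+1) : S n.+1.*2 k 0 =
    if odd k then bpX R * bpY R * bpsq (P11 n k 0) else bpsq (P00 n.+1 k 0).
  have /matrixP/(_ k 0) := hSeven n; rewrite !mxE.
  move=> /(OPS_parity_part hW hS (bpflip_sq _) (flipXY _)) ->.
  by rewrite oddB ?odd_double// -ltnS.
have oddE n (k : 'I_(n.*2.+1).+1) : S n.*2.+1 k 0 =
    if odd k then bpY R * bpsq (P01 n k 0) else bpX R * bpsq (P10 n k 0).
  (* In odd degree, [k] and [n.*2.+1 - k] have opposite parities and the summand even in x is the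
     one with factor y, whence the swap of the sum. *)
  have /matrixP/(_ k 0) := hSodd n; rewrite !mxE addrC.
  move=> /(OPS_parity_part hW hS (flipY _) (flipX _)) ->.
  by rewrite oddB ?oddS ?odd_double -1?ltnS//; case: (odd k).
have weightE i j : triangleW W i j =
    fun z => z.1 ^+ i * z.2 ^+ j * weight00 (diskW W) z.
  by [].
have dim00 n : (n.*2 + 0 + 0 = n.*2)%N by rewrite !addn0.
have dim10 n : (n.*2 + 1 + 0 = n.*2.+1)%N by rewrite addn0 addn1.
have dim01 n : (n.*2 + 0 + 1 = n.*2.+1)%N by rewrite addn0 addn1.
have dim11 n : (n.*2 + 1 + 1 = n.+1.*2)%N by rewrite !addn1.
split.
- suff : monic_OPS (@triangle R) (triangleW W 0 0) (fun n => Jmx R 0 0 n *m P00 n).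
    by rewrite weightE; under eq_fun do rewrite !expr0 !mul1r.
  apply: (triangle_OPS hW hS) => n h.
  have lt : (h.*2 + 0 < (n.*2).+1)%N by have := ltn_ord h; lia.
  pose k : 'I_(n.*2).+1 := inord (h.*2 + 0).
  have kE : k = (h.*2 + 0)%N :> nat by exact: inordK.
  rewrite (@Scast _ (n.*2) _ (dim00 n)) -/k.
  rewrite (@Jmx_mul R 0 0 n _ h k kE) !expr0 !mul1r.
  (* Degree 0 has its own hypothesis [hS0], with a single summand. *)
  clearbody k; case: n h k kE {lt} => [|n] h k kE.
    by have /matrixP/(_ k 0) := hS0; rewrite mxE => ->.
  by rewrite evenE kE oddD odd_double.
- suff : monic_OPS (@triangle R) (triangleW W 1 0) (fun n => Jmx R 1 0 n *m P10 n).
    by rewrite weightE; under eq_fun do rewrite expr0 expr1 mulr1.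
  apply: (triangle_OPS hW hS) => n h.
  have lt : (h.*2 + 0 < (n.*2.+1).+1)%N by have := ltn_ord h; lia.
  pose k : 'I_(n.*2.+1).+1 := inord (h.*2 + 0).
  have kE : k = (h.*2 + 0)%N :> nat by exact: inordK.
  rewrite (@Scast _ (n.*2.+1) _ (dim10 n)) -/k.
  rewrite (@Jmx_mul R 1 0 n _ h k kE) expr0 expr1 mulr1.
  by rewrite oddE kE oddD odd_double.
- suff : monic_OPS (@triangle R) (triangleW W 0 1) (fun n => Jmx R 0 1 n *m P01 n).
    by rewrite weightE; under eq_fun do rewrite expr0 expr1 mul1r.
  apply: (triangle_OPS hW hS) => n h.
  have lt : (h.*2 + 1 < (n.*2.+1).+1)%N by have := ltn_ord h; lia.
  pose k : 'I_(n.*2.+1).+1 := inord (h.*2 + 1).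
  have kE : k = (h.*2 + 1)%N :> nat by exact: inordK.
  rewrite (@Scast _ (n.*2.+1) _ (dim01 n)) -/k.
  rewrite (@Jmx_mul R 0 1 n _ h k kE) expr0 expr1 mul1r.
  by rewrite oddE kE oddD odd_double.
- suff : monic_OPS (@triangle R) (triangleW W 1 1) (fun n => Jmx R 1 1 n *m P11 n).
    by rewrite weightE; under eq_fun do rewrite !expr1.
  apply: (triangle_OPS hW hS) => n h.
  have lt : (h.*2 + 1 < (n.+1.*2).+1)%N by have := ltn_ord h; lia.
  pose k : 'I_(n.+1.*2).+1 := inord (h.*2 + 1).
  have kE : k = (h.*2 + 1)%N :> nat by exact: inordK.
  rewrite (@Scast _ (n.+1.*2) _ (dim11 n)) -/k.
  rewrite (@Jmx_mul R 1 1 n _ h k kE) !expr1.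
  by rewrite evenE kE oddD odd_double.
Qed.
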